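(* Let $\{F^k\}_{k\in\mathbb{N}_0}$ be the pullback attractor of a non-autonomous iterated function system of similarities on $\mathbb{R}^d$ that satisfies the (generalised) Moran open-set condition. If \[ \inf\{\sigma_i:i\in\mathbb{N}\}=\sigma_*>0 \] and there exists $s>0$ such that \[ \sum_{i\in\mathcal{I}_k}\sigma_i^s=1\quad\text{for all }k\in\mathbb{N}, \] then each set $F^k$ is equi-homogeneous with $\dim_{\rm A}F^k=s$.
   Context: $\mathbb{N}=\{1,2,\dots\}$, $\mathbb{N}_0=\mathbb{N}\cup\{0\}$. A non-autonomous iterated function system on $\mathbb{R}^d$ consists of contractions $f_i:\mathbb{R}^d\to\mathbb{R}^d$ ($i\in\mathbb{N}$) with $|f_i(x)-f_i(y)|\le\sigma_i|x-y|$ for all $x,y$, where $\sigma_i\in(0,1)$, and finite index sets $\mathcal{I}_k\subset\mathbb{N}$ ($k\in\mathbb{N}$). It is a system of similarities if this inequality is an equality for every $i$. For $B\subseteq\mathbb{R}^d$ put $\mathcal{S}^k(B)=\bigcup_{i\in\mathcal{I}_{k+1}}f_i(B)$, $\mathcal{S}^{k,l}(B)=\mathcal{S}^k\circ\cdots\circ\mathcal{S}^{l-1}(B)$ for $k<l$, and $\mathcal{S}^{k,k}(B)=B$. Hausdorff semi-distance: $\rho_H(X,Y)=\sup_{x\in X}\inf_{y\in Y}|x-y|$. A pullback attractor is a collection of sets $\{F^k\}_{k\in\mathbb{N}_0}$ in $\mathbb{R}^d$ such that (1) each $F^k$ is compact and the $F^k$ are uniformly bounded; (2) $F^k=\mathcal{S}^k(F^{k+1})$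 for all $k$; (3) $\rho_H(\mathcal{S}^{k,l}(B),F^k)\to0$ as $l\to\infty$ for every $k$ and every bounded $B\subset\mathbb{R}^d$. Generalised Moran open-set condition: there is a uniformly bounded sequence of non-empty open sets $U^k\subset\mathbb{R}^d$ ($k\in\mathbb{N}_0$) such that (i) $\mathcal{S}^k(U^{k+1})\subseteq U^k$; (ii) $f_i(U^k)\cap f_j(U^k)=\emptyset$ for $i,j\in\mathcal{I}_k$, $i\ne j$; (iii) there is $\epsilon_0>0$ with $\lambda(U^k)\ge\epsilon_0$ for all $k\in\mathbb{N}_0$, where $\lambda$ is $d$-dimensional Lebesgue measure. $B_\delta(x)$ is the closed ball of radius $\delta$ and centre $x$, and $\mathcal{N}(A,\delta)$ is the minimum number of closed balls of radius $\delta$ with centres in $A$ whose union contains $A$. A set $F$ is equi-homogeneous if for all $\delta_0>0$ there exist $M\ge 1$ and $c_1,c_2>0$ such that $\sup_{x\in F}\mathcal{N}(B_\delta(x)\cap F,\rho)\le M\inf_{x\in F}\mathcal{N}(B_{c_1\delta}(x)\cap F,c_2\rho)$ for all $\delta,\rho$ with $0<\rho<\delta\le\delta_0$. The Assouad dimension $\dim_{\rm A}F$ is the infimum of all $s\in[0,\infty)$ such that for all $\delta_0>0$ there is $C>0$ with $\sup_{x\in F}\mathcal{N}(B_\delta(x)\cap F,\rho)\le C(\delta/\rho)^s$ for all $0<\rho<\delta\le\delta_0$. *)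

(* Defs.v *)
From HB Require Import structures.
From mathcomp Require Import all_boot all_order all_algebra finmap.
From mathcomp Require Import all_classical all_reals all_analysis.

Set Implicit Arguments.
Unset Strict Implicit.
Unset Printing Implicit Defensive.

Import Order.TTheory GRing.Theory Num.Theory.
Import numFieldNormedType.Exports.

Local Open Scope classical_set_scope.
Local Open Scope ring_scope.

(* Points of R^d are row vectors.  The library norm on 'rV[R]_d is the sup     *)
(* norm; everything metric (similarities, balls, distances) is stated with the *)
(* Euclidean norm below.  The library notions [open], [compact] and            *)
(* [bounded_set] do not depend on this choice, the two norms being equivalent. *)
Definition enorm (R : realType) (d : nat) (x : 'rV[R]_d) : R :=
  Num.sqrt (\sum_(i < d) x 0 i ^+ 2).

Definition eball (R : realType) (d : nat) (x : 'rV[R]_d) (delta : R) :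
    set 'rV[R]_d :=
  [set y | enorm (y - x) <= delta].

Definition box (R : realType) (d : nat) (a b : 'rV[R]_d) : set 'rV[R]_d :=
  [set x | forall i, a 0 i <= x 0 i <= b 0 i].

Definition box_vol (R : realType) (d : nat) (a b : 'rV[R]_d) : R :=
  \prod_(i < d) (b 0 i - a 0 i).

(* d-dimensional Lebesgue measure, as the outer measure obtained from          *)
(* countable covers by boxes; it is only evaluated at open sets here.          *)
Definition lebesgue_rV (R : realType) (d : nat) (A : set 'rV[R]_d) : \bar R :=
  ereal_inf [set (\sum_(0 <= n <oo) (box_vol (ab.1 n) (ab.2 n))%:E)%E
    | ab in [set ab : (nat -> 'rV[R]_d) * (nat -> 'rV[R]_d) |
        (forall n i, ab.1 n 0 i <= ab.2 n 0 i) /\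
        A `<=` \bigcup_n box (ab.1 n) (ab.2 n)]].

(* The maps are labelled by i = 1, 2, ... and the index sets by k = 1, 2, ...; *)
(* the values of all fields at 0 are irrelevant.                               *)
Record nifs (R : realType) (d : nat) := Nifs {
  nifs_map : nat -> 'rV[R]_d -> 'rV[R]_d;
  nifs_ratio : nat -> R;
  nifs_index : nat -> {fset nat};
  nifs_ratio01 : forall i, (0 < i)%N -> 0 < nifs_ratio i < 1;
  nifs_contraction : forall i, (0 < i)%N -> forall x y,
    enorm (nifs_map i x - nifs_map i y) <= nifs_ratio i * enorm (x - y);
  nifs_index_gt0 : forall k, (0 < k)%N ->
    forall i, i \in nifs_index k -> (0 < i)%N
}.

Definition similarities (R : realType) (d : nat) (Phi : nifs R d) : Prop :=
  forall i, (0 < i)%N -> forall x y,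
    enorm (nifs_map Phi i x - nifs_map Phi i y)
    = nifs_ratio Phi i * enorm (x - y).

Definition nifs_step (R : realType) (d : nat) (Phi : nifs R d) (k : nat)
    (B : set 'rV[R]_d) : set 'rV[R]_d :=
  \bigcup_(i in [set` nifs_index Phi k.+1]) (nifs_map Phi i @` B).

Definition nifs_steps (R : realType) (d : nat) (Phi : nifs R d) (k l : nat)
    (B : set 'rV[R]_d) : set 'rV[R]_d :=
  foldr (nifs_step Phi) B (index_iota k l).

(* The supremum is taken in [0, +oo] (hence the extra 0, which only matters    *)
(* when X is empty), and the infimum over the empty set is +oo.                *)
Definition hausdorff_semidist (R : realType) (d : nat) (X Y : set 'rV[R]_d) :
    \bar R :=
  ereal_sup (0%E |`
    [set ereal_inf [set (enorm (x - y))%:E | y in Y] | x in X]).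

Definition pullback_attractor (R : realType) (d : nat) (Phi : nifs R d)
    (F : nat -> set 'rV[R]_d) : Prop :=
  [/\ (forall k, compact (F k)) /\ bounded_set (\bigcup_k F k),
      forall k, F k = nifs_step Phi k (F k.+1) &
      forall k (B : set 'rV[R]_d), bounded_set B ->
        hausdorff_semidist (nifs_steps Phi k l B) (F k) @[l --> \oo] --> 0%E].

Definition moran_open_set_condition (R : realType) (d : nat) (Phi : nifs R d) :
    Prop :=
  exists U : nat -> set 'rV[R]_d,
    [/\ (forall k, open (U k) /\ U k !=set0) /\ bounded_set (\bigcup_k U k),
        forall k, nifs_step Phi k (U k.+1) `<=` U k,
        forall k, (0 < k)%N -> forall i j,
          i \in nifs_index Phi k -> j \in nifs_index Phi k -> i != j ->
          (nifs_map Phi i @` U k) `&` (nifs_map Phi j @` U k) = set0 &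
        exists2 eps0 : R, 0 < eps0 &
          forall k, (eps0%:E <= lebesgue_rV (U k))%E].

(* +oo when no finite cover of the required kind exists. *)
Definition covering_number (R : realType) (d : nat) (A : set 'rV[R]_d)
    (delta : R) : \bar R :=
  ereal_inf [set (#|` c|%fset%:R)%:E | c in [set c : {fset 'rV[R]_d} |
    [set` c] `<=` A /\ A `<=` \bigcup_(x in [set` c]) eball x delta]].

Definition equi_homogeneous (R : realType) (d : nat) (F : set 'rV[R]_d) :
    Prop :=
  forall delta0 : R, 0 < delta0 ->
  exists M c1 c2 : R, [/\ 1 <= M, 0 < c1, 0 < c2 &
    forall delta rho : R, 0 < rho -> rho < delta -> delta <= delta0 ->
      (ereal_sup [set covering_number (eball x delta `&` F) rho | x in F]
       <= M%:E * ereal_inf [set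
            covering_number (eball x (c1 * delta) `&` F) (c2 * rho)
            | x in F])%E].

Definition assouad_dim (R : realType) (d : nat) (F : set 'rV[R]_d) : \bar R :=
  ereal_inf [set s%:E | s in [set s : R | 0 <= s /\
    forall delta0 : R, 0 < delta0 -> exists2 C : R, 0 < C &
      forall delta rho : R, 0 < rho -> rho < delta -> delta <= delta0 ->
        (ereal_sup [set covering_number (eball x delta `&` F) rho | x in F]
         <= (C * (delta / rho) `^ s)%:E)%E]].

(* Main.v *)
Require Import Defs.
From mathcomp Require Import all_boot all_order all_algebra finmap.
From mathcomp Require Import all_classical all_reals all_analysis.
From mathcomp Require Import ring lra.

(** Idea. Cut the coding tree of [F k] along the words whose contraction ratio
   first drops below a scale [t]. The ratios of these words are comparable to
   [t] because [sigma_star > 0], and their [s]-th powers add up to 1, so there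
   are about [t ^ (-s)] of them. The images of the open sets [U] under these
   words are pairwise disjoint and have volume at least a multiple of [t ^ d],
   hence a ball of radius [t] meets at most a constant number of the
   corresponding pieces of [F k]. Both facts together give
   [c (delta / rho) ^ s <= N (B_delta (x) `&` F k, rho) <= C (delta / rho) ^ s]
   with constants that depend only on the bound [delta0] on [delta], and this
   implies both conclusions. *)

Import Order.TTheory GRing.Theory Num.Theory.
Import numFieldNormedType.Exports.

Set Implicit Arguments.
Unset Strict Implicit.
Unset Printing Implicit Defensive.

Local Open Scope classical_set_scope.
Local Open Scope ring_scope.

(** * Euclidean norm and similarities *)

Section norms.
Context {R : realType} {d : nat}.
Implicit Types x y z : 'rV[R]_d.

Lemma row_norm_leP x (r : R) : 0 <= r ->
  reflect (forall i, `|x 0 i| <= r) (`|x| <= r).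
Proof.
move=> r0; rewrite [ `|x| ]/Num.Def.normr/= mx_normrE; apply: (iffP idP).
  move=> /bigmax_leP[_ xr] i; exact: (xr (0, i)).
by move=> xr; apply/bigmax_leP; split => // -[i j] _ /=; rewrite (ord1 i).
Qed.

Lemma sum_sqr_ge0 x : 0 <= \sum_(i < d) x 0 i ^+ 2.
Proof. by apply: sumr_ge0 => i _; exact: sqr_ge0. Qed.

Lemma enorm_ge0 x : 0 <= enorm x.
Proof. exact: sqrtr_ge0. Qed.

Lemma sqr_enorm x : enorm x ^+ 2 = \sum_(i < d) x 0 i ^+ 2.
Proof. by rewrite sqr_sqrtr// sum_sqr_ge0. Qed.

Lemma enorm0 : enorm (0 : 'rV[R]_d) = 0.
Proof.
by rewrite /enorm big1 ?sqrtr0// => i _; rewrite mxE expr0n.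
Qed.

Lemma norm_le_enorm x : `|x| <= enorm x.
Proof.
apply/row_norm_leP; first exact: enorm_ge0.
move=> i; rewrite -sqrtr_sqr ler_sqrt ?sum_sqr_ge0//.
by rewrite (bigD1 i)//= lerDl sumr_ge0// => j _; exact: sqr_ge0.
Qed.

Lemma enorm_le_norm x : enorm x <= d%:R * `|x|.
Proof.
have h : \sum_(i < d) x 0 i ^+ 2 <= (d%:R * `|x|) ^+ 2.
  apply: (@le_trans _ _ (\sum_(i < d) `|x| ^+ 2)).
    apply: ler_sum => i _; rewrite -real_normK ?num_real// lerXn2r ?nnegrE//.
    exact/row_norm_leP.
  rewrite sumr_const card_ord exprMn -[leLHS]mulr_natl ler_wpM2r ?sqr_ge0//.
  case: (d) => [|n]; first by rewrite expr0n.
  by rewrite expr2 ler_peMl// ler1n.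
by rewrite -[leRHS]ger0_norm ?mulr_ge0// -sqrtr_sqr ler_sqrt// sqr_ge0.
Qed.

Lemma enorm_eq0 x : enorm x = 0 -> x = 0.
Proof.
move=> x0; have := norm_le_enorm x; rewrite x0 normr_le0 => /eqP //.
Qed.

End norms.

Section similarity.
Context {R : realType} {d : nat}.
Implicit Types x y z : 'rV[R]_d.

Definition is_similarity (tau : R) (f : 'rV[R]_d -> 'rV[R]_d) :=
  forall x y, enorm (f x - f y) = tau * enorm (x - y).

Lemma enormZ_sqr (a : R) x :
  enorm (a *: x) ^+ 2 = a ^+ 2 * enorm x ^+ 2.
Proof.
by rewrite !sqr_enorm mulr_sumr; apply: eq_bigr => i _; rewrite mxE exprMn.
Qed.

Lemma polarization x y :
  (x *m y^T) 0 0 = (enorm x ^+ 2 + enorm y ^+ 2 - enorm (x - y) ^+ 2) / 2.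
Proof.
rewrite !sqr_enorm -big_split/= -sumrB mulr_suml !mxE; apply: eq_bigr => i _.
by rewrite !mxE; field.
Qed.

(* By polarization, [f - f 0] scales inner products by [tau ^+ 2], so the *)
(* images of the standard basis are the rows of an orthogonal matrix up to *)
(* scaling; inverting that matrix gives preimages. *)
Lemma is_similarity_surj tau f : 0 < tau -> is_similarity tau f ->
  forall z, exists x, f x = z.
Proof.
move=> tau0 hf z.
have tauN0 : tau != 0 by rewrite gt_eqF.
pose g x := tau^-1 *: (f x - f 0).
have gB x y : enorm (g x - g y) ^+ 2 = enorm (x - y) ^+ 2.
  have -> : g x - g y = tau^-1 *: (f x - f y).
    by rewrite /g -scalerBr; congr (_ *: _); rewrite opprB addrA subrK.
  by rewrite enormZ_sqr hf exprMn mulrA -exprMn mulVf// expr1n mul1r.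
have g0 : g 0 = 0 by rewrite /g subrr scaler0.
have gn x : enorm (g x) ^+ 2 = enorm x ^+ 2 by have := gB x 0; rewrite g0 !subr0.
have gdot x y : (g x *m (g y)^T) 0 0 = (x *m y^T) 0 0.
  by rewrite !polarization !gn gB.
pose Q : 'M[R]_d := \matrix_i g (delta_mx 0 i).
have gQ x : g x *m Q^T = x.
  apply/rowP => i; have := gdot x (delta_mx 0 i); rewrite !mxE => h.
  transitivity (\sum_j x 0 j * (delta_mx 0 i : 'rV[R]_d)^T j 0).
    by rewrite -h; apply: eq_bigr => j _; rewrite !mxE.
  rewrite (bigD1 i)//= big1 ?addr0; first by rewrite !mxE !eqxx mulr1.
  by move=> j ji; rewrite !mxE (negbTE ji) andbF mulr0.
have QQ : Q *m Q^T = 1%:M.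
  by apply/row_matrixP => i; rewrite row_mul rowK gQ row1.
have QQ' : Q^T *m Q = 1%:M by apply: mulmx1C.
have gE x : g x = x *m Q.
  by rewrite -[g x]mulmx1 -QQ' mulmxA gQ.
exists ((tau^-1 *: (z - f 0)) *m Q^T).
set x := _ *m _.
have : g x = tau^-1 *: (z - f 0) by rewrite gE /x -mulmxA QQ' mulmx1.
move=> /(congr1 (fun v => tau *: v)).
rewrite /g !scalerA mulfV// !scale1r => /(congr1 (fun v => v + f 0)).
by rewrite !subrK.
Qed.

Lemma is_similarity_inj tau f : 0 < tau -> is_similarity tau f -> injective f.
Proof.
move=> tau0 hf x y fxy; have := hf x y; rewrite fxy subrr enorm0.
move=> /esym/eqP; rewrite mulf_eq0 gt_eqF//= => /eqP/enorm_eq0/eqP.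
by rewrite subr_eq0 => /eqP.
Qed.

End similarity.

(** * Packing of cubes and of similar copies of open sets *)

Section cube_packing.
Context {R : realType} {d : nat}.

(* Count the points of a fine cubic grid: a cube of radius [r i] contains at *)
(* least [(n * r i) ^ d] of them, the ambient one at most [(3 * n * L) ^ d]. *)
Lemma cube_packing (I : finType) (c : I -> 'rV[R]_d) (r : I -> R)
    (z : 'rV[R]_d) (L : R) :
  0 < L -> (forall i, 0 < r i) ->
  (forall i j x, `|x - c i| <= r i -> `|x - c j| <= r j -> i = j) ->
  (forall i x, `|x - c i| <= r i -> `|x - z| <= L) ->
  \sum_i r i ^+ d <= (3 * L) ^+ d.
Proof.
move=> L0 r0 disj sub.
(* The grid spacing [1 / N] is at most [L] and at most every [r i]. Hence rounding [2 * r i * N]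
   down leaves at least [r i * N], and [K.+1 <= 3 * L * N]. *)
pose N := (Num.truncn L^-1 + \sum_i Num.truncn (r i)^-1).+1.
have N0 : (0 : R) < N%:R by rewrite ltr0n.
have truncV (x : R) : 0 < x -> (Num.truncn x^-1 < N)%N -> 1 <= x * N%:R.
  move=> x0 xN; rewrite mulrC -ler_pdivrMr// div1r.
  have x1 : 0 <= x^-1 by rewrite invr_ge0 ltW.
  have /andP[_ /ltW/le_trans] := truncn_itv x1.
  by apply; rewrite ler_nat.
have LN : 1 <= L * N%:R by apply: truncV => //; rewrite ltnS leq_addr.
have rN i : 1 <= r i * N%:R.
  apply: truncV => //; rewrite ltnS (leq_trans _ (leq_addl _ _))//.
  by rewrite (bigD1 i)//= leq_addr.
clearbody N; clear truncV.
pose K := Num.truncn (2 * L * N%:R).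
pose G := {ffun 'I_d -> 'I_K.+1}.
pose pt (g : G) : 'rV[R]_d := \row_j (z 0 j - L + (g j)%:R / N%:R).
pose A i := [set g : G | `|pt g - c i| <= r i]%SET.
have cardA i : (r i * N%:R) ^+ d <= #|A i|%:R.
  pose m := Num.truncn (2 * r i * N%:R).
  have /andP[m1 m2] : m%:R <= 2 * r i * N%:R < m.+1%:R.
    by apply: truncn_itv; rewrite !mulr_ge0// ltW.
  have rm : r i * N%:R <= m%:R by move: m2 (rN i); rewrite -natr1; lra.
  pose a j := c i 0 j - r i - z 0 j + L.
  have a0 j : 0 <= a j /\ a j + 2 * r i <= 2 * L.
    have s1 : `|c i - const_mx (r i) - c i| <= r i.
      apply/row_norm_leP; first exact/ltW.
      by move=> k; rewrite !mxE addrC addKr normrN ger0_norm// ltW.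
    have s2 : `|c i + const_mx (r i) - c i| <= r i.
      apply/row_norm_leP; first exact/ltW.
      by move=> k; rewrite !mxE addrC addKr ger0_norm// ltW.
    have /row_norm_leP := sub _ _ s1; move=> /(_ (ltW L0) j).
    have /row_norm_leP := sub _ _ s2; move=> /(_ (ltW L0) j).
    by rewrite !mxE !ler_norml /a => /andP[_ h1] /andP[h2 _]; split; lra.
  pose t j := Num.truncn (a j * N%:R).
  have tP j : (t j)%:R <= a j * N%:R < (t j).+1%:R.
    by apply: truncn_itv; rewrite mulr_ge0//; case: (a0 j).
  have up j (u : nat) : (u < m)%N ->
      (t j + u).+1%:R <= (a j + 2 * r i) * N%:R.
    move=> um; have : u.+1%:R <= m%:R :> R by rewrite ler_nat.
    have /andP[] := tP j; rewrite -!natr1 natrD; lra.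
  have tK j (u : 'I_m) : ((t j + u).+1 < K.+1)%N.
    rewrite ltnS -(ler_nat R).
    have /andP[_ k2] : K%:R <= 2 * L * N%:R < K.+1%:R.
      by apply: truncn_itv; rewrite !mulr_ge0// ltW.
    have : (t j + u).+1%:R < K.+1%:R :> R.
      apply: le_lt_trans k2; apply: (le_trans (up j u (ltn_ord u))).
      by rewrite ler_wpM2r//; case: (a0 j).
    by rewrite ltr_nat ltnS ler_nat.
  pose phi (u : {ffun 'I_d -> 'I_m}) : G :=
    [ffun j => inord (t j + u j).+1].
  have phiE u j : phi u j = (t j + u j).+1 :> nat by rewrite ffunE inordK.
  have phi_inj : injective phi.
    move=> u v uv; apply/ffunP => j; apply/val_inj/eqP => /=.
    by rewrite -(eqn_add2l (t j)) -eqSS -!phiE uv.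
  have phiA : (phi @: [set: {ffun 'I_d -> 'I_m}])%SET \subset A i.
    apply/fintype.subsetP => _ /imsetP[u _ ->]; rewrite inE.
    apply/row_norm_leP; first exact/ltW.
    move=> j; rewrite !mxE phiE ler_norml; apply/andP.
    have h1 : a j <= (t j + u j).+1%:R / N%:R.
      rewrite ler_pdivlMr//; have /andP[_ /ltW/le_trans] := tP j; apply.
      by rewrite ler_nat ltnS leq_addr.
    have h2 : (t j + u j).+1%:R / N%:R <= a j + 2 * r i.
      by rewrite ler_pdivrMr// up.
    by rewrite /a in h1 h2; split; lra.
  apply: (@le_trans _ _ ((m ^ d)%:R)).
    by rewrite natrX lerXn2r ?nnegrE// mulr_ge0// ltW.
  rewrite ler_nat (leq_trans _ (subset_leq_card phiA))//.
  by rewrite card_imset// cardsT card_ffun !card_ord.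
(* Double counting: by disjointness each grid point lies in at most one of the [A i]. *)
have sumA : (\sum_i #|A i| <= K.+1 ^ d)%N.
  have -> : (K.+1 ^ d = #|G|)%N by rewrite card_ffun !card_ord.
  rewrite -sum1_card.
  under eq_bigr => i _ do rewrite -sum1_card big_mkcond/=.
  rewrite exchange_big/=; apply: leq_sum => g _.
  have [[i gi]|h] := pselect (exists i, g \in A i).
    rewrite (bigD1 i)//= big1 ?addn0; first by case: ifP.
    move=> j ji; case: ifP => // gj; move: gi gj; rewrite !inE => gi gj.
    by rewrite (disj _ _ _ gi gj) eqxx in ji.
  by rewrite big1// => i _; case: ifP => // gi; case: h; exists i.
rewrite -(@ler_pM2r _ (N%:R ^+ d)) ?exprn_gt0//.
rewrite mulr_suml -exprMn.
under eq_bigr do rewrite -exprMn.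
apply: (@le_trans _ _ (K.+1 ^ d)%:R).
  apply: le_trans (ler_sum _ (fun i _ => cardA i)) _.
  by rewrite -natr_sum ler_nat.
rewrite natrX lerXn2r ?nnegrE//; first by rewrite !mulr_ge0// ltW.
have /andP[k1 _] : K%:R <= 2 * L * N%:R < K.+1%:R.
  by apply: truncn_itv; rewrite !mulr_ge0// ltW.
by rewrite -natr1; lra.
Qed.

End cube_packing.

(** * Dyadic cubes inside an open set *)

Section dyadic.
Context {R : realType} {d : nat}.
Variable A : R.
Hypothesis A0 : 0 < A.

(* A dyadic subcube of [-A, A]^d is addressed by the word of binary choices *)
(* leading to it, last choice first. *)
Local Notation choice_ := {ffun 'I_d -> bool}.

Definition dy_side (n : nat) : R := 2 * A / 2 ^+ n.

Fixpoint dy_lo (w : seq choice_) (j : 'I_d) : R :=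
  if w is b :: w' then
    dy_lo w' j + (if b j then dy_side (size w) else 0)
  else - A.

Definition dy_cube (w : seq choice_) : set 'rV[R]_d :=
  [set x | forall j, dy_lo w j <= x 0 j <= dy_lo w j + dy_side (size w)].

Fixpoint dy_words (n : nat) : seq (seq choice_) :=
  if n is n'.+1 then [seq b :: w | w <- dy_words n', b <- enum {: choice_}]
  else [:: [::]].

Lemma dy_side_gt0 n : 0 < dy_side n.
Proof. by rewrite divr_gt0// ?mulr_gt0// exprn_gt0. Qed.

Lemma dy_sideS n : dy_side n = 2 * dy_side n.+1.
Proof.
have h : (2 : R) ^+ n != 0 by rewrite expf_eq0 pnatr_eq0 andbF.
by rewrite /dy_side exprS; field.
Qed.

Lemma mem_dy_words n w : (w \in dy_words n) = (size w == n).
Proof.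
elim: n w => [|n IH] [|b w]//=.
  by apply/negbTE/allpairsPdep => -[? [? []]].
rewrite eqSS -IH; apply/allpairsPdep/idP => [[w' [b' [h _ [_ ->]]]]//|h].
by exists w, b; rewrite mem_enum.
Qed.

Lemma dy_words_uniq n : uniq (dy_words n).
Proof.
elim: n => //= n IH; apply: allpairs_uniq_dep => //.
  by move=> *; exact: enum_uniq.
by move=> [w b] [w' b'] _ _ /= [-> ->].
Qed.

Lemma dy_cube_cons b w : dy_cube (b :: w) `<=` dy_cube w.
Proof.
move=> x xw j; have /= /andP[] := xw j.
have := dy_sideS (size w); have := dy_side_gt0 (size w).+1.
by case: ifP => _ *; apply/andP; split; lra.
Qed.

Lemma dy_cube_exists n x : `|x| <= A ->
  exists w, size w = n /\ dy_cube w x.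
Proof.
move=> xA; elim: n => [|n [w [wn wx]]].
  exists [::]; split => // j /=; rewrite /dy_side expr0.
  have /row_norm_leP := xA; move=> /(_ (ltW A0) j); rewrite ler_norml.
  by move=> /andP[*]; apply/andP; split; lra.
exists ([ffun j => dy_lo w j + dy_side n.+1 <= x 0 j] :: w).
split => [/=|j /=]; first by rewrite wn.
rewrite ffunE wn; have := wx j; rewrite wn dy_sideS => /andP[h1 h2].
by case: ifPn; rewrite -?ltNge => h; apply/andP; split; lra.
Qed.

(** Closed cubes of one level share faces, so the point has to be interior. It is then interior to
    both parents, which agree by induction, and it decides every coordinate of the last choice. *)
Lemma dy_cube_inj w w' x : size w = size w' ->
  (forall j, dy_lo w j < x j < dy_lo w j + dy_side (size w)) ->
  (forall j, dy_lo w' j < x j < dy_lo w' j + dy_side (size w')) ->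
  w = w'.
Proof.
elim: w w' => [|b w IH] [|b' w']//= [ww'] h h'.
have s := dy_sideS (size w); have s0 := dy_side_gt0 (size w).+1.
have E : w = w'.
  apply: IH => // j.
    by have /andP[] := h j; case: ifP => _ *; apply/andP; split; lra.
  rewrite -ww'; have := h' j; rewrite -ww'.
  by case: ifP => _ /andP[*]; apply/andP; split; lra.
congr cons => //; apply/ffunP => j.
have := h' j; have := h j; rewrite -ww' -E; clear - s0.
by case: (b j); case: (b' j) => // /andP[? ?] /andP[? ?];
  exfalso; lra.
Qed.

Variable U : set 'rV[R]_d.

Definition dy_in (w : seq choice_) : bool := `[< dy_cube w `<=` U >].
(** [behead w] addresses the parent cube, so these words give the maximal dyadic cubes inside
    [U]. *)
Definition dy_max (w : seq choice_) : bool :=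
  dy_in w && ~~ ((w != [::]) && dy_in (behead w)).
Definition dy_vol (n : nat) : R := dy_side n ^+ d.

Lemma dy_volS n : dy_vol n = #|{: choice_}|%:R * dy_vol n.+1.
Proof.
by rewrite /dy_vol dy_sideS exprMn card_ffun card_bool card_ord natrX.
Qed.

Lemma dy_vol_ge0 n : 0 <= dy_vol n.
Proof. by rewrite exprn_ge0// ltW// dy_side_gt0. Qed.

(** From level [M] to [M.+1], each cube inside [U] splits into children inside [U] of the same total
    volume; any other cube of level [M.+1] inside [U] has a parent not inside [U], hence is
    maximal. *)
Lemma dy_in_sum M :
  \sum_(n < M.+1) \sum_(w <- dy_words n | dy_max w) dy_vol n =
  \sum_(w <- dy_words M | dy_in w) dy_vol M.
Proof.
elim: M => [|M IH].
  by rewrite big_ord1 /= !big_cons !big_nil /dy_max /= andbT.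
rewrite big_ord_recr/= IH.
rewrite [X in _ + X]big_mkcond [RHS]big_mkcond [X in X + _]big_mkcond.
rewrite !big_allpairs_dep -big_split; apply: eq_bigr => w _ /=.
case: ifPn => wU.
  rewrite big1 ?addr0; last by move=> b _; rewrite /dy_max/= wU andbF.
  rewrite (eq_bigr (fun=> dy_vol M.+1)).
    by rewrite big_enum sumr_const dy_volS mulr_natl.
  move=> b _; rewrite ifT//; apply/asboolP.
  by move/asboolP : wU; apply: subset_trans; exact: dy_cube_cons.
rewrite add0r; apply: eq_bigr => b _; congr (if _ then _ else _).
by rewrite /dy_max /= (negbTE wU) andbT.
Qed.

Lemma dy_max_exists w x : dy_in w -> dy_cube w x ->
  exists2 v, dy_max v & dy_cube v x.
Proof.
elim: w => [|b w IH] wU wx.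
  by exists [::] => //; rewrite /dy_max wU.
case: (boolP (dy_in w)) => h; first by apply: IH => //; exact: dy_cube_cons wx.
by exists (b :: w) => //; rewrite /dy_max wU.
Qed.

Lemma dy_max_cover : open U -> (forall x, U x -> `|x| <= A) ->
  forall x, U x -> exists2 v, dy_max v & dy_cube v x.
Proof.
move=> Uo UA x Ux.
have /nbhs_ballP[e /= e0 eU] : nbhs x U by exact: open_nbhs_nbhs.
have [n ne] : exists n, dy_side n < e.
  pose n := Num.truncn (2 * A / e); exists n.
  rewrite /dy_side ltr_pdivrMr ?exprn_gt0// [e * _]mulrC -ltr_pdivrMr//.
  have e1 : 0 <= 2 * A / e by rewrite divr_ge0 ?mulr_ge0// ltW.
  have /andP[_ /lt_le_trans] := truncn_itv e1; apply.
  by rewrite -natrX ler_nat ltn_expl.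
have [w [wn wx]] := dy_cube_exists n (UA _ Ux).
apply: (dy_max_exists _ wx); apply/asboolP => y yw; apply: eU.
rewrite -ball_normE /=; apply: le_lt_trans ne.
apply/row_norm_leP; first exact/ltW/dy_side_gt0.
move=> j; rewrite !mxE ler_norml; have := wx j; have := yw j; rewrite wn.
by move=> /andP[? ?] /andP[? ?]; apply/andP; split; lra.
Qed.


(** Pickling the words turns the maximal cubes into a sequence over [nat], the form of cover used in
    [lebesgue_rV]; all other indices get volume 0. *)
Let dy_term (j : nat) : R :=
  if pickle_inv j is Some w then if dy_max w then dy_vol (size w) else 0 else 0.

(** Only finitely many words have a code below [J]. With [M] their greatest length, the partial sum
    is part of the left side of [dy_in_sum]. *)
Lemma dy_term_partial_sum J : exists M,
  \sum_(j < J) dy_term j <= \sum_(w <- dy_words M | dy_in w) dy_vol M.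
Proof.
pose sz (j : nat) := if pickle_inv j is Some w then @size choice_ w else 0%N.
exists (\max_(j < J) sz j)%N; set M := (\max_(j < J) _)%N.
rewrite -dy_in_sum.
apply: (@le_trans _ _ (\sum_(j < J) \sum_(n < M.+1)
    \sum_(w <- dy_words n | dy_max w)
      (if choice.pickle w == j then dy_vol n else 0))).
  apply: ler_sum => j _; rewrite /dy_term.
  have pos : 0 <= \sum_(n < M.+1) \sum_(w <- dy_words n | dy_max w)
      (if choice.pickle w == j then dy_vol n else 0).
    by do 2 (apply: sumr_ge0 => ? _); case: ifP => // _; exact: dy_vol_ge0.
  case E : (pickle_inv (j : nat)) => [w|//]; case: ifPn => // wm.
  have wM : (size w < M.+1)%N.
    rewrite ltnS; have := leq_bigmax (F := fun j : 'I_J => sz j) j.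
    by rewrite /sz E.
  have wj : choice.pickle w = j.
    by have := pickle_invK (T := seq choice_) (j : nat); rewrite E.
  rewrite (bigD1 (Ordinal wM))//= ler_wpDr//.
    by do 2 (apply: sumr_ge0 => ? _); case: ifP => // _; exact: dy_vol_ge0.
  rewrite (big_rem w) ?mem_dy_words//= wm wj eqxx ler_wpDr//.
  by apply: sumr_ge0 => ? _; case: ifP => // _; exact: dy_vol_ge0.
rewrite exchange_big; apply: ler_sum => n _.
rewrite exchange_big; apply: ler_sum => w _.
have [wJ|wJ] := boolP (choice.pickle w < J)%N.
  rewrite (bigD1 (Ordinal wJ))//= eqxx big1 ?addr0//.
  move=> i iw; case: ifPn => // /eqP E.
  by move: iw; rewrite -val_eqE /= E eqxx.
rewrite big1 ?dy_vol_ge0// => i _; case: ifPn => // /eqP E.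
by rewrite E ltn_ord in wJ.
Qed.

(** By contradiction: the maximal cubes cover [U], and if every inner sum were at most [e], so would
    be all partial sums of their volumes, and hence the outer measure of [U]. *)
Lemma dy_inner_volume e : (0 < d)%N -> open U -> (forall x, U x -> `|x| <= A) ->
  (e%:E < lebesgue_rV U)%E ->
  exists n, e <= \sum_(w <- dy_words n | dy_in w) dy_vol n.
Proof.
move=> d0 Uo UA eU; apply: contrapT => /forallNP noV.
have V n : \sum_(w <- dy_words n | dy_in w) dy_vol n <= e.
  by move/negP: (noV n); rewrite -ltNge => /ltW.
move: eU; apply/negP; rewrite -leNgt.
pose lo j : 'rV[R]_d := if pickle_inv j is Some w then
  if dy_max w then \row_i dy_lo w i else 0 else 0.
pose hi j : 'rV[R]_d := if pickle_inv j is Some w then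
  if dy_max w then \row_i (dy_lo w i + dy_side (size w)) else 0 else 0.
have volE j : box_vol (lo j) (hi j) = dy_term j.
  (* The filler box has volume 0 because [0 < d]; for [d = 0] the empty product would be 1. *)
  have vol0 : box_vol (0 : 'rV[R]_d) 0 = 0.
    by rewrite /box_vol (bigD1 (Ordinal d0))//= !mxE subrr mul0r.
  rewrite /lo /hi /dy_term; case: pickle_inv => [w|]//; case: ifP => // _.
  rewrite /box_vol (eq_bigr (fun=> dy_side (size w))).
    by rewrite prodr_const card_ord.
  by move=> i _; rewrite !mxE addrC addKr.
have term_ge0 j : 0 <= dy_term j.
  rewrite /dy_term; case: pickle_inv => [w|]//; case: ifP => // _.
  exact: dy_vol_ge0.
apply: (@le_trans _ _ (\sum_(0 <= n <oo) (box_vol (lo n) (hi n))%:E)%E).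
  apply: ereal_inf_lbound; exists (lo, hi) => //; split => /=.
    move=> n i; rewrite /lo /hi; case: pickle_inv => [w|]//.
    case: ifP => // _; rewrite !mxE lerDl; exact/ltW/dy_side_gt0.
  move=> x /(dy_max_cover Uo UA)[w wm wx]; exists (choice.pickle w) => // i.
  by rewrite /lo /hi pickleK_inv wm !mxE; exact: wx.
apply: lime_le.
  by apply: is_cvg_nneseries => n _ _; rewrite lee_fin volE.
apply: nearW => J; rewrite sumEFin lee_fin big_mkord.
under eq_bigr do rewrite volE.
by have [M /le_trans] := dy_term_partial_sum J; apply.
Qed.

End dyadic.

Section inner_cubes.
Context {R : realType} {d : nat}.

(** Dyadic cubes of side [h] inside [U] are shrunk to sup-norm radius [h / 4] about their centres.
    This makes the closed cubes disjoint, and [4 * r] recovers the side [h]. *)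
Lemma inner_cubes (U : set 'rV[R]_d) (A e : R) :
  (0 < d)%N -> open U -> (forall x, U x -> `|x| <= A) ->
  (e%:E < lebesgue_rV U)%E ->
  exists (m : nat) (c : nat -> 'rV[R]_d) (r : R), [/\ 0 < r,
    forall i x, (i < m)%N -> `|x - c i| <= r -> U x,
    forall i j x, (i < m)%N -> (j < m)%N ->
      `|x - c i| <= r -> `|x - c j| <= r -> i = j &
    e <= m%:R * (4 * r) ^+ d].
Proof.
move=> d0 Uo UA0 eU.
pose B := Num.max A 1.
have B0 : 0 < B by rewrite lt_max ltr01 orbT.
have UB x : U x -> `|x| <= B by move=> /UA0 /le_trans; apply; rewrite le_max lexx.
have [n en] := dy_inner_volume B0 d0 Uo UB eU.
pose s := [seq w <- dy_words n | dy_in B U w].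
pose h := dy_side B n.
have h0 : 0 < h by exact: dy_side_gt0.
pose c i : 'rV[R]_d := \row_j (dy_lo B (nth [::] s i) j + h / 2).
have szs i : (i < size s)%N -> size (nth [::] s i) = n.
  by move=> /(mem_nth [::]); rewrite mem_filter mem_dy_words => /andP[_ /eqP].
have cP i x : `|x - c i| <= h / 4 -> forall j,
    dy_lo B (nth [::] s i) j < x 0 j < dy_lo B (nth [::] s i) j + h.
  move=> /row_norm_leP => /(_ (ltW (divr_gt0 h0 _))) xi j.
  have := xi _ j; rewrite !mxE ler_norml => /(_ (ltr0n _ _)) /andP[? ?].
  by apply/andP; split; lra.
exists (size s), c, (h / 4); split.
- by rewrite divr_gt0.
- move=> i x im /cP xc.
  have := mem_nth [::] im; rewrite mem_filter => /andP[/asboolP + _]; apply.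
  by move=> j; rewrite (szs _ im); have /andP[/ltW -> /ltW ->] := xc j.
- move=> i j x im jm /cP xi /cP xj.
  have : nth [::] s i = nth [::] s j.
    apply: (@dy_cube_inj _ _ _ B0 _ _ (x 0)); rewrite ?szs//.
  move/eqP; rewrite nth_uniq// ?filter_uniq ?dy_words_uniq// => /eqP//.
- have -> : 4 * (h / 4) = h by field.
  move: en; rewrite -big_filter big_const_seq count_predT iter_addr_0.
  by rewrite -[leRHS]mulr_natl; exact.
Qed.

End inner_cubes.

(** * Packing of similar copies of open sets *)

Section similarity_packing.
Context {R : realType} {d : nat}.

(** No volume of an image is computed. Each [U i] contains the disjoint cubes of [inner_cubes];
    since similarities are onto, the image of such a cube of radius [r i] contains a cube of radius
    [tau i * r i / d%:R], where [d%:R] compares the two norms. [cube_packing] then applies to all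
    these cubes at once; 12 is the 4 of [inner_cubes] times the 3 of [cube_packing]. *)
Lemma similarity_packing (I : finType) (g : I -> 'rV[R]_d -> 'rV[R]_d)
    (tau : I -> R) (U : I -> set 'rV[R]_d) (A e L : R) (z : 'rV[R]_d) :
  (0 < d)%N -> 0 < L -> (forall i, 0 < tau i) ->
  (forall i, is_similarity (tau i) (g i)) -> (forall i, open (U i)) ->
  (forall i x, U i x -> `|x| <= A) -> (forall i, (e%:E < lebesgue_rV (U i))%E) ->
  (forall i j x y, U i x -> U j y -> g i x = g j y -> i = j) ->
  (forall i x, U i x -> `|g i x - z| <= L) ->
  e * \sum_i tau i ^+ d <= (12 * d%:R * L) ^+ d.
Proof.
move=> d0 L0 tau0 gsim Uo UA eU disj sub.
have dR : (0 : R) < d%:R by rewrite ltr0n.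
have dN0 : d%:R != 0 :> R by rewrite gt_eqF.
have /choice[p pP] : forall i, exists p : nat * (nat -> 'rV[R]_d) * R,
    [/\ 0 < p.2,
    forall k x, (k < p.1.1)%N -> `|x - p.1.2 k| <= p.2 -> U i x,
    forall k l x, (k < p.1.1)%N -> (l < p.1.1)%N ->
      `|x - p.1.2 k| <= p.2 -> `|x - p.1.2 l| <= p.2 -> k = l &
    e <= p.1.1%:R * (4 * p.2) ^+ d].
  move=> i; have [m [c [r H]]] := inner_cubes d0 (Uo i) (@UA i) (eU i).
  by exists (m, c, r).
pose m i := (p i).1.1; pose c i := (p i).1.2; pose r i := (p i).2.
pose J := {i : I & 'I_(m i)}.
pose rad (k : J) := tau (tag k) * r (tag k) / d%:R.
pose ctr (k : J) := g (tag k) (c (tag k) (tagged k)).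
have r0 i : 0 < r i by have [] := pP i.
have rad0 k : 0 < rad k by rewrite divr_gt0// mulr_gt0.
have preim k y : `|y - ctr k| <= rad k ->
    exists2 x, g (tag k) x = y & `|x - c (tag k) (tagged k)| <= r (tag k).
  move=> yk; have [x xy] := is_similarity_surj (tau0 (tag k)) (gsim (tag k)) y.
  exists x => //; apply: le_trans (norm_le_enorm _) _.
  rewrite -(ler_pM2l (tau0 (tag k))) -gsim xy.
  apply: le_trans (enorm_le_norm _) _.
  by rewrite mulrC -ler_pdivlMr.
have preimU k y : `|y - ctr k| <= rad k ->
    exists2 x, g (tag k) x = y & U (tag k) x.
  move=> /preim[x xy xc]; exists x => //; have [_ + _ _] := pP (tag k).
  by apply; [exact: (ltn_ord (tagged k)) | exact: xc].
have : \sum_k rad k ^+ d <= (3 * L) ^+ d.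
  apply: (cube_packing (c := ctr) (z := z)) => //.
  - move=> [i k] [j l] y yk yl.
    have [x xy Ux] := preimU _ _ yk; have [x' xy' Ux'] := preimU _ _ yl.
    have ij : i = j.
      by apply: (disj _ _ _ _ Ux Ux'); rewrite /= in xy xy' *; rewrite xy.
    subst j; congr existT; apply: val_inj.
    have [v vy vc] := preim _ _ yk; have [v' vy' vc'] := preim _ _ yl.
    have vv : v = v' by apply: (is_similarity_inj (tau0 i) (gsim i)); rewrite vy.
    have [_ _ + _] := pP i; apply; [exact: ltn_ord|exact: ltn_ord|exact: vc|].
    by rewrite vv; exact: vc'.
  - by move=> k y /preimU[x <- Ux]; exact: sub.
rewrite (_ : \sum_k _ = \sum_i (m i)%:R * (tau i * r i / d%:R) ^+ d); last first.
  rewrite -(sig_big_dep (fun=> true) (fun _ _ => true)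
    (fun i _ => (tau i * r i / d%:R) ^+ d))/=.
  by apply: eq_bigr => i _; rewrite sumr_const card_ord mulr_natl.
move=> H.
have -> : 12 * d%:R * L = (4 * d%:R) * (3 * L) by ring.
rewrite exprMn.
apply: le_trans (ler_wpM2l _ H); last by rewrite exprn_ge0// mulr_ge0// ltW.
rewrite !mulr_sumr; apply: ler_sum => i _.
have [_ _ _] := pP i; rewrite -/(m i) -/(r i) => He.
rewrite mulrCA -exprMn.
have -> : 4 * d%:R * (tau i * r i / d%:R) = 4 * r i * tau i by field.
by rewrite exprMn mulrA ler_wpM2r// exprn_ge0// ltW.
Qed.

End similarity_packing.

(** * Words and the cut at a given scale *)

Section words.
Context {R : realType} {d : nat}.
Variable Phi : nifs R d.

Definition word_map (w : seq nat) (x : 'rV[R]_d) := foldr (nifs_map Phi) x w.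

Definition word_ratio (w : seq nat) : R := \prod_(i <- w) nifs_ratio Phi i.

(* [w] labels a composition of the form S^k o ... o S^(k + size w - 1). *)
Fixpoint word_from (k : nat) (w : seq nat) : bool :=
  if w is i :: w' then (i \in nifs_index Phi k.+1) && word_from k.+1 w'
  else true.

(* The words along which the contraction ratio first drops to [t] or below; *)
(* [n] bounds the recursion depth, and once it is large the words do not depend *)
(* on it. *)
Fixpoint cut (n k : nat) (t : R) : seq (seq nat) :=
  if n is n'.+1 then
    if 1 <= t then [:: [::]]
    else [seq i :: w | i <- nifs_index Phi k.+1,
                       w <- cut n' k.+1 (t / nifs_ratio Phi i)]
  else [:: [::]].

Lemma word_ratio_nil : word_ratio [::] = 1.
Proof. exact: big_nil. Qed.

Lemma word_ratio_cons i w :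
  word_ratio (i :: w) = nifs_ratio Phi i * word_ratio w.
Proof. exact: big_cons. Qed.

Lemma index_gt0 k i : i \in nifs_index Phi k.+1 -> (0 < i)%N.
Proof. exact: nifs_index_gt0. Qed.

Lemma ratio_gt0 k i : i \in nifs_index Phi k.+1 -> 0 < nifs_ratio Phi i.
Proof. by move=> /index_gt0 ik; have /andP[] := nifs_ratio01 Phi ik. Qed.

Lemma ratio_lt1 k i : i \in nifs_index Phi k.+1 -> nifs_ratio Phi i < 1.
Proof. by move=> /index_gt0 ik; have /andP[] := nifs_ratio01 Phi ik. Qed.

Lemma word_ratio_gt0 k w : word_from k w -> 0 < word_ratio w.
Proof.
elim: w k => [|i w IH] k /=; first by rewrite word_ratio_nil.
by move=> /andP[/ratio_gt0 i0 /IH w0]; rewrite word_ratio_cons mulr_gt0.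
Qed.

Lemma cutP n k t w : w \in cut n.+1 k t -> t < 1 -> exists i v,
  [/\ w = i :: v, i \in nifs_index Phi k.+1 &
      v \in cut n k.+1 (t / nifs_ratio Phi i)].
Proof.
move=> /= + t1; rewrite leNgt t1 /= => /allpairsPdep[i [v [? ? ->]]].
by exists i, v.
Qed.

Lemma cut_ge1 n k t : 1 <= t -> cut n k t = [:: [::]].
Proof. by case: n => //= n ->. Qed.

Lemma cut_from n k t w : w \in cut n k t -> word_from k w.
Proof.
elim: n k t w => [|n IH] k t w; first by rewrite inE => /eqP ->.
have [t1|t1] := leP 1 t; first by rewrite cut_ge1// inE => /eqP ->.
by move=> /cutP/(_ t1)[i [v [-> ik /IH]]] /= ->; rewrite ik.
Qed.

Lemma cut_uniq n k t : uniq (cut n k t).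
Proof.
elim: n k t => //= n IH k t; case: ifP => // _.
apply: allpairs_uniq_dep => //; first exact: fset_uniq.
by move=> [i w] [i' w'] _ _ /= [-> ->].
Qed.

(** The first letter factors out of each weight: the inner sums are 1 by induction, and so is the
    sum of the weights of the first letters. *)
Lemma cut_sum s n k t :
  (forall k, (0 < k)%N ->
    \sum_(i <- nifs_index Phi k) nifs_ratio Phi i `^ s = 1) ->
  \sum_(w <- cut n k t) word_ratio w `^ s = 1.
Proof.
move=> sum1; elim: n k t => [|n IH] k t /=.
  by rewrite big_seq1 word_ratio_nil powR1.
case: ifP => _; first by rewrite big_seq1 word_ratio_nil powR1.
rewrite big_allpairs_dep -[RHS](sum1 k.+1)//=.
apply: eq_big_seq => i ik; rewrite -[RHS]mulr1 -(IH k.+1 (t / nifs_ratio Phi i)).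
rewrite mulr_sumr; apply: eq_big_seq => w /cut_from wk.
by rewrite word_ratio_cons powRM// ltW ?(ratio_gt0 ik)// (word_ratio_gt0 wk).
Qed.

(** The condition [theta ^+ n <= t] keeps the depth bound from stopping the recursion too early:
    each letter has ratio at most [theta] and uses up one factor, so at depth 0 the remaining scale
    is at least 1. *)
Lemma cut_le theta n k t w : 0 < theta ->
  (forall k i, i \in nifs_index Phi k.+1 -> nifs_ratio Phi i <= theta) ->
  theta ^+ n <= t -> w \in cut n k t -> word_ratio w <= t.
Proof.
move=> th0 th; elim: n k t w => [|n IH] k t w nt.
  by rewrite inE => /eqP ->; rewrite word_ratio_nil -(expr0 theta).
have [t1|t1] := leP 1 t.
  by rewrite cut_ge1// inE => /eqP ->; rewrite word_ratio_nil.
move=> /cutP/(_ t1)[i [v [-> ik vt]]]; rewrite word_ratio_cons mulrC.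
rewrite -ler_pdivlMr ?(ratio_gt0 ik)//; apply: IH vt.
rewrite ler_pdivlMr ?(ratio_gt0 ik)//; apply: le_trans nt.
rewrite exprSr; apply: ler_wpM2l; [exact/exprn_ge0/ltW|exact: (th k)].
Qed.

(** A letter is added only while the remaining scale is below 1, and the last one costs at most a
    factor [sigma]. The first alternative is for the empty word, since [t] may be arbitrarily
    large. *)
Lemma cut_ge sigma n k t w : 0 < t ->
  (forall i, (0 < i)%N -> sigma <= nifs_ratio Phi i) ->
  w \in cut n k t -> word_ratio w = 1 \/ sigma * t <= word_ratio w.
Proof.
move=> + sig; elim: n k t w => [|n IH] k t w t0.
  by rewrite inE => /eqP ->; rewrite word_ratio_nil; left.
have [t1|t1] := leP 1 t.
  by rewrite cut_ge1// inE => /eqP ->; rewrite word_ratio_nil; left.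
move=> /cutP/(_ t1)[i [v [-> ik vt]]]; right; rewrite word_ratio_cons.
have i0 := ratio_gt0 ik.
have [->|h] := IH _ _ _ (divr_gt0 t0 i0) vt.
  have si := sig i (index_gt0 ik).
  have [s0|s0] := leP 0 sigma.
    by rewrite mulr1 (le_trans _ si)// ler_piMr// ltW.
  by rewrite mulr1 (@le_trans _ _ 0) ?ltW// nmulr_rlt0.
apply: le_trans (ler_wpM2l (ltW i0) h).
by rewrite mulrCA [_ * (t / _)]mulrC divfK// gt_eqF.
Qed.

Lemma word_map_in (F : nat -> set 'rV[R]_d) k w y :
  (forall k, nifs_step Phi k (F k.+1) `<=` F k) ->
  word_from k w -> F (k + size w)%N y -> F k (word_map w y).
Proof.
move=> HF; elim: w k => [|i w IH] k /=; first by rewrite addn0.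
rewrite addnS -addSn => /andP[ik wk] Fy; apply: HF.
by exists i => //; exists (word_map w y) => //; exact: IH.
Qed.

Lemma cut_cover (F : nat -> set 'rV[R]_d) n k t x :
  (forall k, F k `<=` nifs_step Phi k (F k.+1)) -> F k x ->
  exists w y, [/\ w \in cut n k t, F (k + size w)%N y & word_map w y = x].
Proof.
move=> HF; elim: n k t x => [|n IH] k t x Fx.
  by exists [::], x; rewrite inE addn0.
have [t1|t1] := leP 1 t.
  by exists [::], x; rewrite cut_ge1// inE addn0.
have [i /= ik [z Fz <-]] := HF _ _ Fx.
have [w [y [wc Fy <-]]] := IH _ (t / nifs_ratio Phi i) _ Fz.
exists (i :: w), y; split => //=; last by rewrite addnS -addSn.
by rewrite leNgt t1 /=; apply/allpairsPdep; exists i, w.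
Qed.

Hypothesis sim : similarities Phi.

Lemma word_map_sim k w : word_from k w ->
  is_similarity (word_ratio w) (word_map w).
Proof.
elim: w k => [|i w IH] k /=; first by move=> _ x y; rewrite word_ratio_nil mul1r.
move=> /andP[/index_gt0 ik /IH h] x y /=.
by rewrite word_ratio_cons (sim ik) h mulrA.
Qed.

(** Injectivity strips common first letters; where the words first differ, the Moran condition
    separates the images. Neither word can end before that, because both are cut at the same
    remaining scale and depth. *)
Lemma cut_disjoint (U : nat -> set 'rV[R]_d) n k t w v x y :
  (forall k, nifs_step Phi k (U k.+1) `<=` U k) ->
  (forall k, (0 < k)%N -> forall i j,
    i \in nifs_index Phi k -> j \in nifs_index Phi k -> i != j ->
    (nifs_map Phi i @` U k) `&` (nifs_map Phi j @` U k) = set0) ->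
  w \in cut n k t -> v \in cut n k t ->
  U (k + size w)%N x -> U (k + size v)%N y ->
  word_map w x = word_map v y -> w = v.
Proof.
move=> HU disj; elim: n k t w v => [|n IH] k t w v.
  by rewrite !inE => /eqP -> /eqP ->.
have [t1|t1] := leP 1 t; first by rewrite !cut_ge1// !inE => /eqP -> /eqP ->.
move=> /cutP/(_ t1)[i [w' [-> ik wt]]] /cutP/(_ t1)[j [v' [-> jk vt]]] /=.
rewrite !addnS -!addSn => Ux Uy E.
have ij : i = j.
  apply/eqP/negPn/negP => /(disj k.+1 isT _ _ ik jk); apply/eqP/set0P.
  exists (nifs_map Phi i (word_map w' x)); split.
    by exists (word_map w' x) => //; apply: word_map_in (cut_from wt) Ux.
  by rewrite E; exists (word_map v' y) => //; apply: word_map_in (cut_from vt) Uy.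
subst j; congr cons; apply: IH wt vt Ux Uy _.
have i0 := ratio_gt0 ik.
by apply: (is_similarity_inj i0 _ E); exact: sim (index_gt0 ik).
Qed.

Lemma ratio_bound (s sigma : R) : 0 < s -> 0 < sigma ->
  (forall i, (0 < i)%N -> sigma <= nifs_ratio Phi i) ->
  (forall k, (0 < k)%N ->
    \sum_(i <- nifs_index Phi k) nifs_ratio Phi i `^ s = 1) ->
  exists theta : R, [/\ 0 < theta, theta < 1 &
    forall k i, i \in nifs_index Phi k.+1 -> nifs_ratio Phi i <= theta].
Proof.
move=> s0 sig0 sig sum1.
pose q := 1 - sigma `^ s.
have qi k i : i \in nifs_index Phi k.+1 -> nifs_ratio Phi i `^ s <= q.
  move=> ik; have := sum1 k.+1 isT; rewrite (big_rem i)//=.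
  case E : (rem i _) => [|j l].
    rewrite big_nil addr0 => h; have := ratio_lt1 ik.
    have := gt0_ltr_powR s0 (ltW (ratio_gt0 ik)) ler01 (ratio_lt1 ik).
    by rewrite h powR1 ltxx.
  rewrite big_cons /q => h.
  have jk : j \in nifs_index Phi k.+1.
    by apply: (mem_rem (x := i)); rewrite E mem_head.
  have j1 : sigma `^ s <= nifs_ratio Phi j `^ s.
    rewrite ge0_ler_powR ?nnegrE// ?(ltW s0) ?(ltW sig0) ?(ltW (ratio_gt0 jk))//.
    exact: sig (index_gt0 jk).
  have : 0 <= \sum_(i <- l) nifs_ratio Phi i `^ s.
    by apply: sumr_ge0 => *; exact: powR_ge0.
  lra.
have q1 : q < 1 by rewrite /q ltrBlDr ltrDl powR_gt0.
have [i0 i0k] : exists i, i \in nifs_index Phi 1.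
  have := sum1 1%N isT; case E : (enum_fset (nifs_index Phi 1)) => [|i l].
    by rewrite big_nil => /esym/eqP; rewrite oner_eq0.
  by move=> _; exists i; rewrite -[_ \in _]/(i \in enum_fset _) E mem_head.
have q0 : 0 < q.
  by apply: lt_le_trans (qi 0%N i0 i0k); rewrite powR_gt0// (ratio_gt0 i0k).
exists (q `^ s^-1); split; first by rewrite powR_gt0.
  have := @gt0_ltr_powR R s^-1 _ q 1 (ltW q0) ler01 q1.
  by rewrite powR1; apply; rewrite invr_gt0.
move=> k i ik; have r0 := ratio_gt0 ik.
have -> : nifs_ratio Phi i = (nifs_ratio Phi i `^ s) `^ s^-1.
  by rewrite -powRrM mulfV ?gt_eqF// powRr1// ltW.
apply: ge0_ler_powR; rewrite ?nnegrE ?powR_ge0//.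
- by rewrite invr_ge0 ltW.
- exact: ltW.
- exact: (qi k).
Qed.

End words.

(** * Covering estimates for the attractor *)

Lemma size_natr (R : pzSemiRingType) (T : Type) (l : seq T) :
  (size l)%:R = \sum_(x <- l) 1 :> R.
Proof. by rewrite big_const_seq count_predT iter_addr_0. Qed.

Section attractor.
Context {R : realType} {d : nat}.
Variables (Phi : nifs R d) (F U : nat -> set 'rV[R]_d).
Variables (s sigma theta A e diam : R).
Hypothesis d_gt0 : (0 < d)%N.
Hypothesis sim : similarities Phi.
Hypothesis s_gt0 : 0 < s.
Hypothesis sum1 : forall k, (0 < k)%N ->
  \sum_(i <- nifs_index Phi k) nifs_ratio Phi i `^ s = 1.
Hypothesis sigma_gt0 : 0 < sigma.
Hypothesis sigma_le : forall i, (0 < i)%N -> sigma <= nifs_ratio Phi i.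
Hypothesis theta_gt0 : 0 < theta.
Hypothesis theta_lt1 : theta < 1.
Hypothesis theta_ge : forall k i, i \in nifs_index Phi k.+1 ->
  nifs_ratio Phi i <= theta.
Hypothesis diam_gt0 : 0 < diam.
Hypothesis F_diam : forall k x y, F k x -> F k y -> enorm (x - y) <= diam.
Hypothesis UF_diam : forall k x y, U k x -> F k y -> enorm (x - y) <= diam.
Hypothesis U_bound : forall k x, U k x -> `|x| <= A.
Hypothesis U_open : forall k, open (U k).
Hypothesis U_step : forall k, nifs_step Phi k (U k.+1) `<=` U k.
Hypothesis U_disj : forall k, (0 < k)%N -> forall i j,
  i \in nifs_index Phi k -> j \in nifs_index Phi k -> i != j ->
  (nifs_map Phi i @` U k) `&` (nifs_map Phi j @` U k) = set0.
Hypothesis e_gt0 : 0 < e.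
Hypothesis U_vol : forall k, (e%:E < lebesgue_rV (U k))%E.
Hypothesis F_step : forall k, F k = nifs_step Phi k (F k.+1).
Hypothesis F_ne : forall k, F k !=set0.

Lemma theta_pow_le (t : R) : 0 < t -> exists n, theta ^+ n <= t.
Proof.
move=> t0.
have : (fun n => theta ^+ n) @ \oo --> (0 : R).
  by apply: cvg_expr; rewrite gtr0_norm.
move=> /cvgrPdist_le/(_ t t0)[n _ /(_ n (leqnn n))] /=.
by rewrite sub0r normrN => h; exists n; apply: le_trans (ler_norm _) h.
Qed.

(** For [t <= T] the empty word has ratio [1 >= T^-1 * t], so the two alternatives of [cut_ge]
    merge. This is how the constants come to depend on [delta0]. *)
Lemma cut_ratio_ge (T : R) : 0 < T -> exists2 c : R, 0 < c &
  forall n k t w, 0 < t -> t <= T -> w \in cut Phi n k t ->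
    c * t <= word_ratio Phi w.
Proof.
move=> T0; exists (Num.min sigma T^-1).
  by rewrite lt_min sigma_gt0 invr_gt0.
move=> n k t w t0 tT wc.
have [->|] := cut_ge t0 sigma_le wc.
  apply: (@le_trans _ _ (T^-1 * t)).
    by rewrite ler_wpM2r ?(ltW t0)// ge_min lexx orbT.
  by rewrite mulrC ler_pdivrMr// mul1r.
by apply: le_trans; rewrite ler_wpM2r ?(ltW t0)// ge_min lexx.
Qed.

Definition touches k (z : 'rV[R]_d) (t : R) (w : seq nat) : bool :=
  `[< exists2 y, F (k + size w)%N y & enorm (word_map Phi w y - z) <= t >].

(** For each counted word, the image of [U] lies within [diam * t] of a point of the piece that is
    within [t] of [z]. These disjoint images thus fit into a ball of radius [(diam + 1) * t], while
    their ratios are at least [c * t], so [similarity_packing] bounds their number. *)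
Lemma count_touches (T : R) : 0 < T -> exists2 N : R, 0 < N &
  forall n k t z, 0 < t -> t <= T -> theta ^+ n <= t ->
    (count (touches k z t) (cut Phi n k t))%:R <= N.
Proof.
move=> T0; have [c c0 Hc] := cut_ratio_ge T0.
pose L := 12 * d%:R * (diam + 1).
have D0 := diam_gt0.
have L0 : 0 < L by rewrite !mulr_gt0// ?ltr0n// addr_gt0.
exists ((L / c) ^+ d / e); first by rewrite divr_gt0// exprn_gt0// divr_gt0.
move=> n k t z t0 tT nt.
pose v := [seq w <- cut Phi n k t | touches k z t w].
rewrite -size_filter -/v.
pose w (i : 'I_(size v)) := nth [::] v i.
have wv i : w i \in v by exact: mem_nth.
have wc i : w i \in cut Phi n k t by have := wv i; rewrite mem_filter => /andP[].
have wt i : touches k z t (w i) by have := wv i; rewrite mem_filter => /andP[].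
have H : e * \sum_(i < size v) word_ratio Phi (w i) ^+ d <=
    (12 * d%:R * ((diam + 1) * t)) ^+ d.
  apply: (@similarity_packing R d _ (fun i => word_map Phi (w i)) _
    (fun i => U (k + size (w i))%N) A _ _ z) => //.
  - by rewrite mulr_gt0// addr_gt0.
  - by move=> i; exact: word_ratio_gt0 (cut_from (wc i)).
  - by move=> i; exact: word_map_sim sim _ _ (cut_from (wc i)).
  - by move=> i x; exact: U_bound.
  - move=> i j x y Ux Uy E; apply/val_inj/eqP => /=.
    rewrite -(nth_uniq [::] (ltn_ord i) (ltn_ord j)) ?filter_uniq ?cut_uniq//.
    by apply/eqP; exact: (cut_disjoint sim U_step U_disj (wc i) (wc j) Ux Uy E).
  - move=> i x Ux; have /asboolP[y Fy yz] := wt i.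
    rewrite -(subrKA (word_map Phi (w i) y)).
    apply: le_trans (ler_normD _ _) _.
    rewrite mulrDl mul1r lerD//; last exact: le_trans (norm_le_enorm _) yz.
    apply: le_trans (norm_le_enorm _) _.
    rewrite (word_map_sim sim (cut_from (wc i))) mulrC ler_pM ?enorm_ge0//.
    + exact/ltW/(word_ratio_gt0 (cut_from (wc i))).
    + exact: UF_diam Ux Fy.
    + exact: cut_le theta_gt0 theta_ge nt (wc i).
rewrite ler_pdivlMr// expr_div_n ler_pdivlMr ?exprn_gt0//.
rewrite -(ler_pM2r (exprn_gt0 d t0)).
have -> : L ^+ d * t ^+ d = (12 * d%:R * ((diam + 1) * t)) ^+ d.
  by rewrite -exprMn /L; congr (_ ^+ _); ring.
apply: le_trans H.
have -> : (size v)%:R * e * c ^+ d * t ^+ d = e * ((size v)%:R * (c * t) ^+ d).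
  by rewrite exprMn; ring.
rewrite ler_pM2l//.
rewrite mulr_natl -[X in _ *+ X]card_ord -sumr_const; apply: ler_sum => i _.
rewrite lerXn2r ?nnegrE ?mulr_ge0 ?(ltW c0) ?(ltW t0)//.
  exact/ltW/(word_ratio_gt0 (cut_from (wc i))).
by apply: (Hc n k) => //.
Qed.

(** The weights in the cut sum to 1 and each is at most [t]^ s[, so there are at least]t^-1 [^ s]
    words. Each piece meets the ball of some centre, and a centre serves at most [N] words. The
    centres need not lie in [F k], which allows for preimages of centres in [cover_lower]. *)
Lemma cover_lower_global (T : R) : 0 < T -> exists2 c : R, 0 < c &
  forall k t (C : seq 'rV[R]_d), 0 < t -> t <= T ->
    (forall x, F k x -> exists2 z, z \in C & enorm (x - z) <= t) ->
    c * t^-1 `^ s <= (size C)%:R.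
Proof.
move=> T0; have [N N0 HN] := count_touches T0.
exists N^-1; first by rewrite invr_gt0.
move=> k t C t0 tT cov; have [n nt] := theta_pow_le t0.
rewrite mulrC ler_pdivrMr//.
apply: (@le_trans _ _ (size (cut Phi n k t))%:R).
  rewrite size_natr -[leLHS]mul1r -{1}(cut_sum n k t sum1) mulr_suml.
  rewrite big_seq [leRHS]big_seq; apply: ler_sum => w wc.
  have w0 := word_ratio_gt0 (cut_from wc).
  rewrite -powRM ?invr_ge0 ?(ltW w0) ?(ltW t0)//.
  have wt : word_ratio Phi w / t <= 1.
    by rewrite ler_pdivrMr// mul1r; exact: cut_le theta_gt0 theta_ge nt wc.
  have := @ge0_ler_powR R s (ltW s_gt0) (word_ratio Phi w / t) 1.
  by rewrite powR1; apply; rewrite ?nnegrE ?divr_ge0// ltW.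
apply: (@le_trans _ _ (\sum_(z <- C) N)); last first.
  by rewrite big_const_seq count_predT iter_addr_0 mulr_natl.
apply: (@le_trans _ _ (\sum_(z <- C) (count (touches k z t) (cut Phi n k t))%:R)).
  rewrite -natr_sum ler_nat -sum1_size.
  under [leqRHS]eq_bigr do rewrite -sum1_count big_mkcond.
  rewrite exchange_big big_seq [leqRHS]big_seq; apply: leq_sum => w wc.
  have [y Fy] := F_ne (k + size w).
  have /cov[z zC yz] : F k (word_map Phi w y).
    by apply: word_map_in (cut_from wc) Fy => l; rewrite -F_step.
  by rewrite (big_rem z)//= ifT//; apply/asboolP; exists y.
by apply: ler_sum => z _; exact: HN.
Qed.

(** Choose a piece containing [x] in the cut at scale [delta / diam]. Its diameter is at most
    [delta], so the ball contains it, and the inverse similarity turns the given cover into one of a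
    whole later set [F (k + size w)] at scale [rho / word_ratio Phi w]. *)
Lemma cover_lower (delta0 : R) : 0 < delta0 -> exists2 c : R, 0 < c &
  forall k x delta rho (C : seq 'rV[R]_d), F k x ->
    0 < rho -> rho < delta -> delta <= delta0 ->
    (forall y, F k y -> enorm (y - x) <= delta ->
       exists2 z, z \in C & enorm (y - z) <= rho) ->
    c * (delta / rho) `^ s <= (size C)%:R.
Proof.
move=> dd0; have D0 := diam_gt0; have DN0 : diam != 0 by rewrite gt_eqF.
have [c1 c10 Hc1] := cut_ratio_ge (divr_gt0 dd0 D0).
have c1D : 0 < c1 / diam by rewrite divr_gt0.
have cV0 : 0 < (c1 / diam)^-1 by rewrite invr_gt0.
have [c c0 Hc] := cover_lower_global cV0.
exists (c * (c1 / diam) `^ s); first by rewrite mulr_gt0// powR_gt0.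
move=> k x delta rho C Fx rho0 rd dd cov.
have d0 := lt_trans rho0 rd.
have t0 : 0 < delta / diam by rewrite divr_gt0.
have [n nt] := theta_pow_le t0.
have [w [y [wc Fy yx]]] : exists w y, [/\ w \in cut Phi n k (delta / diam),
    F (k + size w)%N y & word_map Phi w y = x].
  by apply: cut_cover Fx => l; rewrite -F_step.
have w0 := word_ratio_gt0 (cut_from wc).
have wsim := word_map_sim sim (cut_from wc).
have w1 : word_ratio Phi w <= delta / diam by exact: cut_le nt wc.
have w2 : c1 / diam * delta <= word_ratio Phi w.
  rewrite mulrAC -mulrA; apply: (Hc1 n k) wc => //.
  by rewrite ler_pM2r ?invr_gt0.
have /choice[h hE] := is_similarity_surj w0 wsim.
have : c * (rho / word_ratio Phi w)^-1 `^ s <= (size (map h C))%:R.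
  apply: (Hc (k + size w)%N).
  - by rewrite divr_gt0.
  (* The rescaled radius is at most [diam / c1], since [rho < delta] and the ratio is at least
     [c1 / diam * delta]. *)
  - rewrite ler_pdivrMr// ler_pdivlMl//; apply: le_trans w2.
    by rewrite ler_pM2l// ltW.
  - move=> y' Fy'; have [||z zC yz] := cov (word_map Phi w y').
    + by apply: word_map_in (cut_from wc) Fy' => l; rewrite -F_step.
    + rewrite -yx wsim -(divfK DN0 delta).
      by apply: ler_pM; rewrite ?enorm_ge0 ?(ltW w0)//; exact: F_diam Fy' Fy.
    + exists (h z); first exact: map_f.
      by rewrite ler_pdivlMr// mulrC -wsim hE.
rewrite size_map; apply: le_trans; rewrite -mulrA ler_pM2l//.
rewrite invf_div -powRM ?divr_ge0 ?(ltW c10) ?(ltW D0) ?(ltW d0) ?(ltW rho0)//.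
apply: ge0_ler_powR; rewrite ?nnegrE ?(ltW s_gt0)//.
- by rewrite mulr_ge0 ?divr_ge0 ?ltW.
- by rewrite divr_ge0 ?ltW.
- by rewrite mulrA ler_pM2r ?invr_gt0.
Qed.


Lemma size_cut (T : R) : 0 < T -> exists2 C : R, 0 < C &
  forall n k t, 0 < t -> t <= T -> (size (cut Phi n k t))%:R <= C * t^-1 `^ s.
Proof.
move=> T0; have [c c0 Hc] := cut_ratio_ge T0.
exists ((c^-1) `^ s); first by rewrite powR_gt0// invr_gt0.
move=> n k t t0 tT; rewrite -powRM ?invr_ge0 ?(ltW c0) ?(ltW t0)//.
have ct0 : 0 < c * t by rewrite mulr_gt0.
rewrite -invfM -(powR_inv1 (ltW ct0)) -powRrM mulN1r powRN -[leRHS]mul1r.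
rewrite ler_pdivlMr ?powR_gt0// size_natr -[leRHS](cut_sum n k t sum1) mulr_suml.
rewrite [leLHS]big_seq [leRHS]big_seq; apply: ler_sum => w wc.
rewrite mul1r; apply: ge0_ler_powR; rewrite ?nnegrE ?(ltW s_gt0) ?(ltW ct0)//.
  exact/ltW/(word_ratio_gt0 (cut_from wc)).
exact: (Hc n k).
Qed.

Lemma word_map_cat w v x :
  word_map Phi (w ++ v) x = word_map Phi w (word_map Phi v x).
Proof. by rewrite /word_map foldr_cat. Qed.

Lemma word_from_cat k w v :
  word_from Phi k (w ++ v) = word_from Phi k w && word_from Phi (k + size w) v.
Proof.
elim: w k => [|i w IH] k /=; first by rewrite addn0.
by rewrite IH addnS addSn andbA.
Qed.

Lemma cover_upper (delta0 : R) : 0 < delta0 -> exists2 C : R, 0 < C &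
  forall k x delta rho, F k x -> 0 < rho -> rho < delta -> delta <= delta0 ->
    exists c : seq 'rV[R]_d, [/\
      forall z, z \in c -> F k z /\ enorm (z - x) <= delta,
      forall y, F k y -> enorm (y - x) <= delta ->
        exists2 z, z \in c & enorm (y - z) <= rho &
      (size c)%:R <= C * (delta / rho) `^ s].
Proof.
move=> dd0; have D0 := diam_gt0; have DN0 : diam != 0 by rewrite gt_eqF.
have [c1 c10 Hc1] := cut_ratio_ge dd0.
have [N N0 HN] := count_touches dd0.
have c1D : 0 < (diam * c1)^-1 by rewrite invr_gt0 mulr_gt0.
have [C C0 HC] := size_cut c1D.
exists (N * (C * diam `^ s)); first by rewrite !mulr_gt0// powR_gt0.
move=> k x delta rho Fx rho0 rd dd.
have d0 := lt_trans rho0 rd.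
have [n nd] := theta_pow_le d0.
(* With this scale the refined pieces of [b] have diameter at most
   [word_ratio Phi b * t b * diam = rho]. *)
pose t b := rho / (diam * word_ratio Phi b).
have tP b : b \in cut Phi n k delta -> 0 < t b /\ t b <= (diam * c1)^-1.
  move=> bc; have b0 := word_ratio_gt0 (cut_from bc).
  split; first by rewrite divr_gt0// mulr_gt0.
  rewrite /t -[leRHS]mul1r ler_pdivrMr ?mulr_gt0// mulrAC ler_pdivlMr ?mulr_gt0//.
  rewrite mul1r mulrCA ler_pM2l//; apply: le_trans (Hc1 n k _ _ d0 dd bc).
  by rewrite mulrC ler_pM2l// ltW.
have /choice[m mP] : forall b, exists m,
    b \in cut Phi n k delta -> theta ^+ m <= t b.
  move=> b; have [bc|bc] := boolP (b \in cut Phi n k delta); last by exists 0%N.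
  by have [m] := theta_pow_le (tP _ bc).1; exists m.
pose B := [seq b <- cut Phi n k delta | touches k x delta b].
pose V := [seq b ++ w | b <- B, w <- cut Phi (m b) (k + size b) (t b)].
(* The centres must lie in [F k] and in the ball. For a refined word, [p] picks a point of its piece
   inside the ball if there is one, and [pmap] drops the other words. *)
pose Q v z := [/\ exists2 y, F (k + size v)%N y & word_map Phi v y = z &
  enorm (z - x) <= delta].
pose p v :=
  if pselect (exists z, Q v z) is left h then Some (sval (cid h)) else None.
have pQ v z : p v = Some z -> Q v z.
  by rewrite /p; case: pselect => // h [<-]; exact: (svalP (cid h)).
have BP b : b \in B -> b \in cut Phi n k delta by rewrite mem_filter => /andP[].
have FS l : nifs_step Phi l (F l.+1) `<=` F l by rewrite -F_step.
have FS' l : F l `<=` nifs_step Phi l (F l.+1) by rewrite -F_step.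
exists (pmap p V); split.
- move=> z; rewrite mem_pmap => /mapP[v /allpairsPdep[b [w [bB wc ->]]]].
  move=> /esym/pQ[[y Fy <-] zx]; split => //.
  apply: (word_map_in FS) Fy; rewrite word_from_cat (cut_from (BP _ bB)).
  exact: cut_from wc.
- move=> z Fz zx.
  have [b [y [bc Fy yz]]] := cut_cover (Phi := Phi) n delta FS' Fz.
  have bB : b \in B.
    by rewrite mem_filter bc andbT; apply/asboolP; exists y; rewrite ?yz.
  have [w [y' [wc Fy' yy']]] := cut_cover (Phi := Phi) (m b) (t b) FS' Fy.
  have vV : b ++ w \in V by apply/allpairsPdep; exists b, w.
  have Qz : Q (b ++ w) z.
    by split => //; exists y'; rewrite ?size_cat ?addnA// word_map_cat yy'.
  have [q pq] : exists q, p (b ++ w) = Some q.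
    rewrite /p; case: pselect => [h|[]]; last by exists z.
    by exists (sval (cid h)).
  exists q; first by rewrite mem_pmap -pq map_f.
  have [[y'' Fy'' <-] _] := pQ _ _ pq.
  rewrite word_map_cat -yz -yy' (word_map_sim sim (cut_from bc)).
  rewrite (word_map_sim sim (cut_from wc)).
  have b0 := word_ratio_gt0 (cut_from bc).
  rewrite mulrC -ler_pdivlMr//.
  have -> : rho / word_ratio Phi b = t b * diam.
    by rewrite /t; field; rewrite DN0 gt_eqF.
  apply: ler_pM; rewrite ?enorm_ge0 ?(ltW (word_ratio_gt0 (cut_from wc)))//.
    exact: cut_le theta_gt0 theta_ge (mP _ bc) wc.
  by apply: F_diam Fy' _; rewrite -addnA -size_cat.
- apply: (@le_trans _ _ (size V)%:R).
    by rewrite ler_nat size_pmap (leq_trans (count_size _ _))// size_map.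
  rewrite size_allpairs_dep sumnE big_map natr_sum.
  apply: (@le_trans _ _ (\sum_(b <- B) C * diam `^ s * (delta / rho) `^ s)).
    rewrite big_seq [leRHS]big_seq; apply: ler_sum => b /BP bc.
    have [t0 tT] := tP _ bc.
    apply: le_trans (HC _ _ _ t0 tT) _; rewrite -mulrA ler_pM2l//.
    have b0 := word_ratio_gt0 (cut_from bc).
    rewrite invf_div -powRM ?divr_ge0 ?(ltW D0) ?(ltW d0) ?(ltW rho0)//.
    apply: ge0_ler_powR; rewrite ?nnegrE ?(ltW s_gt0)//.
    + by rewrite divr_ge0 ?mulr_ge0// ltW.
    + by rewrite mulr_ge0 ?divr_ge0// ltW.
    + rewrite -mulrA ler_pM2l// ler_pM2r ?invr_gt0//.
      exact: cut_le theta_gt0 theta_ge nd bc.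
  rewrite big_const_seq count_predT iter_addr_0 -[leLHS]mulr_natl -!mulrA.
  rewrite ler_wpM2r ?mulr_ge0 ?powR_ge0 ?(ltW C0)//.
  by rewrite size_filter; exact: HN.
Qed.

End attractor.

(** * Covering numbers, equi-homogeneity and Assouad dimension *)

Section covering_number.
Context {R : realType} {d : nat}.
Implicit Types A : set 'rV[R]_d.

Lemma covering_number_le A (rho B : R) (c : seq 'rV[R]_d) :
  (forall z, z \in c -> A z) ->
  (forall y, A y -> exists2 z, z \in c & enorm (y - z) <= rho) ->
  (size c)%:R <= B -> (covering_number A rho <= B%:E)%E.
Proof.
move=> cA cov cB; apply: (@le_trans _ _ ((#|` [fset x in c]%fset|%:R)%:E)).
  apply: ereal_inf_lbound; exists [fset x in c]%fset => //; split.
    by move=> z /=; rewrite inE; exact: cA.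
  by move=> y /cov[z zc yz]; exists z => //=; rewrite inE.
rewrite lee_fin (le_trans _ cB)// ler_nat card_fseq; exact: size_undup.
Qed.

Lemma covering_number_ge A (rho B : R) :
  (forall c : seq 'rV[R]_d,
    (forall y, A y -> exists2 z, z \in c & enorm (y - z) <= rho) ->
    B <= (size c)%:R) -> (B%:E <= covering_number A rho)%E.
Proof.
move=> H; apply: le_ereal_inf_tmp => _ [c [_ cov] <-]; rewrite lee_fin.
by apply: H => y /cov[z zc yz]; exists z.
Qed.

End covering_number.

Section two_sided_bounds.
Context {R : realType} {d : nat}.
Variables (F : set 'rV[R]_d) (s : R).
Hypothesis s_ge0 : 0 <= s.
Hypothesis F_ne : F !=set0.
Hypothesis lower : forall delta0, 0 < delta0 -> exists2 c : R, 0 < c &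
  forall x delta rho, F x -> 0 < rho -> rho < delta -> delta <= delta0 ->
    ((c * (delta / rho) `^ s)%:E <= covering_number (eball x delta `&` F) rho)%E.
Hypothesis upper : forall delta0, 0 < delta0 -> exists2 C : R, 0 < C &
  forall x delta rho, F x -> 0 < rho -> rho < delta -> delta <= delta0 ->
    (covering_number (eball x delta `&` F) rho <= (C * (delta / rho) `^ s)%:E)%E.

Lemma equi_homogeneous_of_bounds : equi_homogeneous F.
Proof.
move=> delta0 dd0; have [c c0 Hc] := lower dd0; have [C C0 HC] := upper dd0.
exists (Num.max 1 (C / c)), 1, 1; split => //; first by rewrite le_max lexx.
move=> delta rho rho0 rd dd; rewrite !mul1r.
have M0 : 0 < Num.max 1 (C / c) by rewrite lt_max ltr01.
apply: (@le_trans _ _ (C * (delta / rho) `^ s)%:E).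
  by apply: ge_ereal_sup => _ [x Fx <-]; exact: HC.
apply: (@le_trans _ _ ((Num.max 1 (C / c))%:E * (c * (delta / rho) `^ s)%:E)%E).
  rewrite -EFinM lee_fin mulrA ler_wpM2r ?powR_ge0//.
  by rewrite -ler_pdivrMr// le_max lexx orbT.
apply: lee_wpmul2l; first by rewrite lee_fin ltW.
by apply: le_ereal_inf_tmp => _ [x Fx <-]; exact: Hc.
Qed.

(** An admissible exponent [t < s] would give [c * y]^ s <= C * y [^ t] for [delta = 1] and
    [rho = y^-1], which fails for large [y]. *)
Lemma assouad_dim_of_bounds : assouad_dim F = s%:E.
Proof.
apply/eqP; rewrite eq_le; apply/andP; split.
  apply: ereal_inf_lbound; exists s => //; split => // delta0 dd0.
  have [C C0 HC] := upper dd0; exists C => // delta rho rho0 rd dd.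
  by apply: ge_ereal_sup => _ [x Fx <-]; exact: HC.
apply: le_ereal_inf_tmp => _ [t [t0 Ht] <-]; rewrite lee_fin leNgt.
apply/negP => ts.
have [c c0 Hc] := lower (ltr01 : 0 < 1 :> R); have [C C0 HC] := Ht 1 ltr01.
have [x Fx] := F_ne.
have st0 : 0 < s - t by rewrite subr_gt0.
have Cc0 : 0 < C / c by rewrite divr_gt0.
pose y := (1 + C / c) `^ (s - t)^-1.
have y0 : 0 < y by rewrite powR_gt0// addr_gt0.
have y1 : 1 < y.
  have := @gt0_ltr_powR R (s - t)^-1 _ 1 (1 + C / c) ler01.
  rewrite powR1; apply; rewrite ?invr_gt0 ?ltrDl//.
  by rewrite nnegrE addr_ge0// ltW.
have yV : y^-1 < 1 by rewrite invf_lt1.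
have yV0 : 0 < y^-1 by rewrite invr_gt0.
have sup : ((c * (1 / y^-1) `^ s)%:E <= (C * (1 / y^-1) `^ t)%:E)%E.
  apply: le_trans (HC 1 y^-1 yV0 yV (lexx _)).
  apply: le_trans (Hc x 1 y^-1 Fx yV0 yV (lexx _)) _.
  by apply: ereal_sup_ubound; exists x.
move: sup; rewrite lee_fin div1r invrK => sup.
have : y `^ (s - t) <= C / c.
  rewrite ler_pdivlMr// mulrC -(ler_pM2r (powR_gt0 t y0)) -mulrA -powRD.
    by rewrite subrK.
  by rewrite (gt_eqF y0) implybT.
rewrite /y -powRrM mulVf ?gt_eqF// powRr1; last by rewrite addr_ge0// ltW.
by rewrite gerDr ler10.
Qed.

End two_sided_bounds.

(** * Non-emptiness of the attractor *)

Section nonempty.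
Context {R : realType} {d : nat}.
Variables (Phi : nifs R d) (F : nat -> set 'rV[R]_d).

Lemma nifs_steps_nonempty k l (B : set 'rV[R]_d) :
  (forall k, exists i, i \in nifs_index Phi k.+1) -> B !=set0 ->
  nifs_steps Phi k l B !=set0.
Proof.
move=> ne B0; rewrite /nifs_steps; elim: (index_iota k l) => //= m v [x vx].
have [i ik] := ne m.
by exists (nifs_map Phi i x); exists i => //; exists x.
Qed.

(** Attraction of the bounded set [[set 0]] forces this: its iterates are non-empty, so their
    semi-distance to an empty [F k] would always be [+oo], whereas convergence to 0 makes it
    eventually finite. *)
Lemma attractor_nonempty : (forall k, exists i, i \in nifs_index Phi k.+1) ->
  pullback_attractor Phi F -> forall k, F k !=set0.
Proof.
move=> ne [_ _ attr] k; apply/set0P/eqP => F0.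
have /(attr k)/fine_cvgP[[n _ fin] _] : bounded_set [set (0 : 'rV[R]_d)].
  exists 0; split => // M M0 x /= ->; rewrite normr0 ltW//.
have := fin n (leqnn n); rewrite /= F0.
have B0 : [set (0 : 'rV[R]_d)] !=set0 by exists 0.
have [x Bx] := nifs_steps_nonempty k n ne B0.
suff -> : hausdorff_semidist (nifs_steps Phi k n [set 0]) set0 = +oo%E by [].
apply/eqP; rewrite -leye_eq; apply: ereal_sup_ubound; right.
by exists x => //; rewrite image_set0 ereal_inf0.
Qed.

End nonempty.

(** * Equi-homogeneity and dimension of the attractor *)

Unset Implicit Arguments.

Theorem theorem1p6 (R : realType) (d : nat) (d_gt0 : (0 < d)%N)
    (Phi : nifs R d) (F : nat -> set 'rV[R]_d) (sigma_star s : R) :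
  similarities Phi ->
  moran_open_set_condition Phi ->
  pullback_attractor Phi F ->
  inf [set nifs_ratio Phi i | i in [set i | (0 < i)%N]] = sigma_star ->
  0 < sigma_star ->
  0 < s ->
  (forall k, (0 < k)%N ->
    \sum_(i <- nifs_index Phi k) nifs_ratio Phi i `^ s = 1) ->
  forall k, equi_homogeneous (F k) /\ assouad_dim (F k) = s%:E.
Proof.
move=> sim [U [[Uo Ubd] Ustep Udisj [eps0 eps0_gt0 Uvol]]] attr infE sig0 s0 sum1 k.
have [[_ Fbd] Fstep _] := attr.
have sigma_le i : (0 < i)%N -> sigma_star <= nifs_ratio Phi i.
  move=> i0; rewrite -infE; apply: ge_inf; last by exists i.
  exists 0 => _ [j j0 <-].
  by have /andP[/ltW] := nifs_ratio01 Phi j0.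
have [theta [th0 th1 thge]] := ratio_bound s0 sig0 sigma_le sum1.
have index_ne l : exists i, i \in nifs_index Phi l.+1.
  have := sum1 l.+1 isT; case E : (enum_fset (nifs_index Phi l.+1)) => [|i v].
    by rewrite big_nil => /esym/eqP; rewrite oner_eq0.
  by move=> _; exists i; rewrite -[_ \in _]/(i \in enum_fset _) E mem_head.
have Fne := attractor_nonempty index_ne attr.
have [A A0 [FA UA]] : exists2 A : R, 0 < A &
    (forall l x, F l x -> `|x| <= A) /\ (forall l x, U l x -> `|x| <= A).
  have [M1 [_ H1]] := Fbd; have [M2 [_ H2]] := Ubd.
  (* [bounded_set] gives a bound by every number strictly above [M1] or [M2], hence the [+ 1]. *)
  pose M := Num.max 1 (Num.max (M1 + 1) (M2 + 1)).
  exists M; first by rewrite lt_max ltr01.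
  split => l x lx; [apply: (H1 M) | apply: (H2 M)]; do ?by exists l.
    by rewrite !lt_max ltrDl ltr01 !orbT.
  by rewrite !lt_max ltrDl ltr01 !orbT.
have dR : (0 : R) < d%:R by rewrite ltr0n.
have diam_gt0 : 0 < d%:R * (2 * A) by rewrite !mulr_gt0.
have le_diam (x y : 'rV[R]_d) : `|x| <= A -> `|y| <= A ->
    enorm (x - y) <= d%:R * (2 * A).
  move=> xA yA; apply: le_trans (enorm_le_norm _) _; rewrite ler_wpM2l//.
  by apply: le_trans (ler_normB _ _) _; rewrite mulr_natl mulr2n lerD.
have FF l x y : F l x -> F l y -> enorm (x - y) <= d%:R * (2 * A).
  by move=> /FA xA /FA; exact: le_diam.
have UF l x y : U l x -> F l y -> enorm (x - y) <= d%:R * (2 * A).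
  by move=> /UA xA /FA; exact: le_diam.
(* Halving [eps0] turns the volume bound into the strict inequality used in the packing
   estimates. *)
have e0 : 0 < eps0 / 2 by rewrite divr_gt0.
have Uvol' l : ((eps0 / 2)%:E < lebesgue_rV (U l))%E.
  by apply: lt_le_trans (Uvol l); rewrite lte_fin ltr_pdivrMr// ltr_pMr// ltr1n.
have lower : forall delta0, 0 < delta0 -> exists2 c : R, 0 < c &
    forall x delta rho, F k x -> 0 < rho -> rho < delta -> delta <= delta0 ->
    ((c * (delta / rho) `^ s)%:E <= covering_number (eball x delta `&` F k) rho)%E.
  move=> delta0 dd0.
  have [c c0 Hc] := cover_lower d_gt0 sim s0 sum1 sig0 sigma_le th0 th1 thge
    diam_gt0 FF UF UA (fun l => (Uo l).1) Ustep Udisj e0 Uvol' Fstep Fne dd0.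
  exists c => // x delta rho Fx rho0 rd dd; apply: covering_number_ge => C cov.
  apply: (Hc k x) => // y Fy yx; exact: cov.
have upper : forall delta0, 0 < delta0 -> exists2 C : R, 0 < C &
    forall x delta rho, F k x -> 0 < rho -> rho < delta -> delta <= delta0 ->
    (covering_number (eball x delta `&` F k) rho <= (C * (delta / rho) `^ s)%:E)%E.
  move=> delta0 dd0.
  have [C C0 HC] := cover_upper d_gt0 sim s0 sum1 sig0 sigma_le th0 th1 thge
    diam_gt0 FF UF UA (fun l => (Uo l).1) Ustep Udisj e0 Uvol' Fstep dd0.
  exists C => // x delta rho Fx rho0 rd dd.
  have [c [cF cov cC]] := HC k x delta rho Fx rho0 rd dd.
  apply: covering_number_le cC => [z /cF[] //|y [yx Fy]]; exact: cov.
split; first exact: (equi_homogeneous_of_bounds lower upper).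
exact: (assouad_dim_of_bounds (ltW s0) (Fne k) lower upper).
Qed.
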